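(* Let $(\mathfrak g,[\cdot,\cdot,\cdot],\alpha,\beta)$ and $(\mathfrak g',[\cdot,\cdot,\cdot]',\alpha',\beta')$ be 3-Bihom-Lie superalgebras over a field $\mathbb K$ and let $f:\mathfrak g\to\mathfrak g'$ be a linear map. Then $f$ is a morphism of 3-Bihom-Lie superalgebras if and only if its graph $\phi_f=\{x+f(x)\mid x\in\mathfrak g\}\subset\mathfrak g\oplus\mathfrak g'$ is a 3-Bihom subalgebra of $(\mathfrak g\oplus\mathfrak g',[\cdot,\cdot,\cdot]_{\mathfrak g\oplus\mathfrak g'},\alpha+\alpha',\beta+\beta')$.
   Context: For a homogeneous element $x$, $|x|\in\mathbb Z_2$ denotes its degree; identities involving $|x|$ are for homogeneous elements. A 3-Bihom-Lie superalgebra over $\mathbb K$ is a quadruple $(\mathfrak g,[\cdot,\cdot,\cdot],\alpha,\beta)$ consisting of a $\mathbb Z_2$-graded vector space $\mathfrak g=\mathfrak g_0\oplus\mathfrak g_1$, an even trilinear map $[\cdot,\cdot,\cdot]:\mathfrak g\times\mathfrak g\times\mathfrak g\to\mathfrak g$ and two even linear maps $\alpha,\beta:\mathfrak g\to\mathfrak g$ such that for all $x,y,z,u,v\in\mathfrak g$: (1) $\alpha\circ\beta=\beta\circ\alpha$; (2) $\alpha([x,y,z])=[\alpha(x),\alpha(y),\alpha(z)]$ and $\beta([x,y,z])=[\beta(x),\beta(y),\beta(z)]$; (3) $[\beta(x),\beta(y),\alpha(z)]=-(-1)^{|x||y|}[\beta(y),\beta(x),\alpha(z)]=-(-1)^{|y||z|}[\beta(x),\beta(z),\alpha(y)]$;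 (4) $[\beta^2(x),\beta^2(y),[\beta(z),\beta(u),\alpha(v)]]=(-1)^{(|u|+|v|)(|x|+|y|+|z|)}[\beta^2(u),\beta^2(v),[\beta(x),\beta(y),\alpha(z)]]-(-1)^{(|z|+|v|)(|x|+|y|)+|u||v|}[\beta^2(z),\beta^2(v),[\beta(x),\beta(y),\alpha(u)]]+(-1)^{(|z|+|u|)(|x|+|y|)}[\beta^2(z),\beta^2(u),[\beta(x),\beta(y),\alpha(v)]]$. The direct sum structure on $\mathfrak g\oplus\mathfrak g'$ is $[u_1+v_1,u_2+v_2,u_3+v_3]_{\mathfrak g\oplus\mathfrak g'}=[u_1,u_2,u_3]+[v_1,v_2,v_3]'$, $(\alpha+\alpha')(u+v)=\alpha(u)+\alpha'(v)$, $(\beta+\beta')(u+v)=\beta(u)+\beta'(v)$ for $u,u_i\in\mathfrak g$, $v,v_i\in\mathfrak g'$; it is a 3-Bihom-Lie superalgebra. A linear map $f:\mathfrak g\to\mathfrak g'$ is a morphism of 3-Bihom-Lie superalgebras if $f([x,y,z])=[f(x),f(y),f(z)]'$ for all $x,y,z\in\mathfrak g$, $f\circ\alpha=\alpha'\circ f$ and $f\circ\beta=\beta'\circ f$. A linear subspace $\eta$ of a 3-Bihom-Lie superalgebra $(\mathfrak g,[\cdot,\cdot,\cdot],\alpha,\beta)$ is a 3-Bihom subalgebra if $\alpha(\eta)\subset\eta$, $\beta(\eta)\subset\eta$ and $[x,y,z]\in\eta$ for all $x,y,z\in\eta$. *)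

(* Defs.v *)
From HB Require Import structures.
From mathcomp Require Import all_boot all_algebra.
From mathcomp Require Import classical_sets.

Set Implicit Arguments.
Unset Strict Implicit.
Unset Printing Implicit Defensive.

Import GRing.Theory.
Local Open Scope classical_set_scope.
Local Open Scope ring_scope.

Definition subspace (K : fieldType) (V : lmodType K) (A : set V) : Prop :=
  submod_closed (mem A).

(* V = G 0 (+) G 1. *)
Definition is_grading (K : fieldType) (V : lmodType K) (G : 'Z_2 -> set V) :
    Prop :=
  [/\ forall i, subspace (G i),
      forall x, exists x0 x1, [/\ G 0 x0, G 1 x1 & x = x0 + x1]
    & G 0 `&` G 1 = [set 0]].

Definition trilinear (K : fieldType) (V : lmodType K) (b : V -> V -> V -> V) :
    Prop :=
  [/\ forall y z, linear (fun x => b x y z),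
      forall x z, linear (fun y => b x y z)
    & forall x y, linear (fun z => b x y z)].

(* (-1)^i; the argument is a polynomial in degrees, computed in Z/2. *)
Definition sgn (K : fieldType) (i : 'Z_2) : K := (-1) ^+ (i : nat).
Arguments sgn K i : clear implicits.

(* An identity involving |x| is stated for every x in the component of degree
   i, with i in place of |x|; since 0 lies in both components it is then
   required of 0 for both degrees, where it holds trivially by linearity. *)
Record bihom3_lie_superalgebra (K : fieldType) := Bihom3LieSuperalgebra {
  carrier :> lmodType K;
  homog : 'Z_2 -> set carrier;
  bracket : carrier -> carrier -> carrier -> carrier;
  alpha : {linear carrier -> carrier};
  beta : {linear carrier -> carrier};
  homog_grading : is_grading homog;
  bracket_trilinear : trilinear bracket;
  bracket_even : forall i j k x y z, homog i x -> homog j y -> homog k z ->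
    homog (i + j + k) (bracket x y z);
  alpha_even : forall i x, homog i x -> homog i (alpha x);
  beta_even : forall i x, homog i x -> homog i (beta x);
  alpha_beta : forall x, alpha (beta x) = beta (alpha x);
  alpha_bracket : forall x y z,
    alpha (bracket x y z) = bracket (alpha x) (alpha y) (alpha z);
  beta_bracket : forall x y z,
    beta (bracket x y z) = bracket (beta x) (beta y) (beta z);
  bracket_skew12 : forall i j k x y z, homog i x -> homog j y -> homog k z ->
    bracket (beta x) (beta y) (alpha z) =
      - (sgn K (i * j) *: bracket (beta y) (beta x) (alpha z));
  bracket_skew23 : forall i j k x y z, homog i x -> homog j y -> homog k z ->
    bracket (beta x) (beta y) (alpha z) =
      - (sgn K (j * k) *: bracket (beta x) (beta z) (alpha y));
  bracket_jacobi : forall dx dy dz du dv x y z u v,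
    homog dx x -> homog dy y -> homog dz z -> homog du u -> homog dv v ->
    bracket (beta (beta x)) (beta (beta y))
        (bracket (beta z) (beta u) (alpha v)) =
      sgn K ((du + dv) * (dx + dy + dz)) *:
        bracket (beta (beta u)) (beta (beta v))
          (bracket (beta x) (beta y) (alpha z))
      - sgn K ((dz + dv) * (dx + dy) + du * dv) *:
        bracket (beta (beta z)) (beta (beta v))
          (bracket (beta x) (beta y) (alpha u))
      + sgn K ((dz + du) * (dx + dy)) *:
        bracket (beta (beta z)) (beta (beta u))
          (bracket (beta x) (beta y) (alpha v)) }.

Definition is_morphism (K : fieldType) (g g' : bihom3_lie_superalgebra K)
    (f : {linear g -> g'}) : Prop :=
  [/\ forall x y z, f (bracket x y z) = bracket (f x) (f y) (f z),
      forall x, f (alpha g x) = alpha g' (f x)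
    & forall x, f (beta g x) = beta g' (f x)].

Definition bihom3_subalgebra (K : fieldType) (g : bihom3_lie_superalgebra K)
    (eta : set g) : Prop :=
  [/\ subspace eta,
      alpha g @` eta `<=` eta,
      beta g @` eta `<=` eta
    & forall x y z, eta x -> eta y -> eta z -> eta (bracket x y z)].

Section DirectSum.
Variable K : fieldType.

Section SumMap.
Variables (V W : lmodType K) (a : {linear V -> V}) (b : {linear W -> W}).

Definition sum_map (p : V * W) : V * W := (a p.1, b p.2).

Fact sum_map_is_linear : linear sum_map.
Proof. by move=> c p q; rewrite /sum_map /= !linearP. Qed.

HB.instance Definition _ :=
  GRing.isLinear.Build K (V * W)%type (V * W)%type *:%R sum_map
    sum_map_is_linear.

End SumMap.

Variables g g' : bihom3_lie_superalgebra K.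

Definition sum_homog (i : 'Z_2) : set (g * g') :=
  [set p | homog i p.1 /\ homog i p.2].

Definition sum_bracket (p q r : g * g') : g * g' :=
  (bracket p.1 q.1 r.1, bracket p.2 q.2 r.2).

Fact sum_grading : is_grading sum_homog.
Proof.
have [S D I] := homog_grading g; have [S' D' I'] := homog_grading g'.
split=> [i|[x y]|].
- have [z l] := S i; have [z' l'] := S' i; split.
    by rewrite inE; split; [move: z|move: z']; rewrite inE.
  move=> c p q; rewrite !inE => -[p1 p2] [q1 q2]; split.
    by have := l c p.1 q.1; rewrite !inE; apply.
  by have := l' c p.2 q.2; rewrite !inE; apply.
- have [x0 [x1 [h0 h1 ->]]] := D x; have [y0 [y1 [k0 k1 ->]]] := D' y.
  by exists (x0, y0), (x1, y1).
- apply/seteqP; split=> [[x y] [[/= a b] [/= c d]]|_ ->] /=.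
    have -> : x = 0 by have: (homog 0 `&` homog 1) x by []; rewrite I.
    by have -> : y = 0 by have: (homog 0 `&` homog 1) y by []; rewrite I'.
  have [a b] : (homog 0 `&` homog 1) (0 : g) by rewrite I.
  by have [c d] : (homog 0 `&` homog 1) (0 : g') by rewrite I'.
Qed.

Fact sum_trilinear : trilinear sum_bracket.
Proof.
have [A B C] := bracket_trilinear g; have [A' B' C'] := bracket_trilinear g'.
by split=> p q c u v; apply/pair_equal_spec; split;
  [exact: A|exact: A'|exact: B|exact: B'|exact: C|exact: C'].
Qed.

Definition direct_sum : bihom3_lie_superalgebra K.
Proof.
refine (@Bihom3LieSuperalgebra K (g * g')%type sum_homog sum_bracket
  (sum_map (alpha g) (alpha g')) (sum_map (beta g) (beta g'))
  sum_grading sum_trilinear _ _ _ _ _ _ _ _ _).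
- by move=> i j k x y z [? ?] [? ?] [? ?]; split; apply: bracket_even.
- by move=> i x [? ?]; split; apply: alpha_even.
- by move=> i x [? ?]; split; apply: beta_even.
- by move=> x; rewrite /= /sum_map /= !alpha_beta.
- by move=> x y z; rewrite /= /sum_map /= !alpha_bracket.
- by move=> x y z; rewrite /= /sum_map /= !beta_bracket.
- move=> i j k x y z [? ?] [? ?] [? ?]; apply/pair_equal_spec.
  by split; apply: bracket_skew12; eassumption.
- move=> i j k x y z [? ?] [? ?] [? ?]; apply/pair_equal_spec.
  by split; apply: bracket_skew23; eassumption.
- move=> i j k l m x y z u v [? ?] [? ?] [? ?] [? ?] [? ?].
  by apply/pair_equal_spec; split; apply: bracket_jacobi.
Defined.

End DirectSum.

Definition graph (K : fieldType) (g g' : bihom3_lie_superalgebra K)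
    (f : {linear g -> g'}) : set (direct_sum g g') :=
  [set ((x, f x) : g * g') | x in [set: g]].

(* Main.v *)
Require Import Defs.
From mathcomp Require Import all_boot all_algebra.
From mathcomp Require Import classical_sets.

Import GRing.Theory.

(** The graph is cut out by the equation [f p.1 = p.2] ([graphP]), and the direct sum operates
    componentwise. So closure of the graph under the bracket, [alpha] or [beta], read at points
    [(x, f x)], says exactly that [f] commutes with that operation. Linearity of [f] makes the graph
    a subspace. *)

Lemma graphP (K : fieldType) (g g' : bihom3_lie_superalgebra K)
    (f : {linear g -> g'}) (p : direct_sum g g') :
  graph f p <-> f p.1 = p.2.
Proof.
by split=> [[x _ <-] //|]; case: p => x y /= <-; exists x.
Qed.

Lemma subspace_graph (K : fieldType) (g g' : bihom3_lie_superalgebra K)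
    (f : {linear g -> g'}) :
  subspace (graph f).
Proof.
split=> [|c p q]; rewrite !inE; first by apply/graphP; rewrite /= linear0.
by move=> /graphP fp /graphP fq; apply/graphP; rewrite /= linearP fp fq.
Qed.

Theorem proposition2p17 (K : fieldType) (g g' : bihom3_lie_superalgebra K)
    (f : {linear g -> g'}) :
  is_morphism f <-> bihom3_subalgebra (graph f).
Proof.
have mem_graph x : graph f (x, f x) by apply/graphP.
split=> [[fM fa fb]|[_ Ga Gb GM]].
  split; first exact: subspace_graph.
  - by move=> _ [p /graphP fp <-]; apply/graphP; rewrite /= fa fp.
  - by move=> _ [p /graphP fp <-]; apply/graphP; rewrite /= fb fp.
  move=> p q r /graphP fp /graphP fq /graphP fr.
  by apply/graphP; rewrite /= fM fp fq fr.
(* Applying an operation to points [(x, f x)] fixes the first component of the result; membership in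
   the graph then forces the second to be its image under [f]. *)
split=> [x y z|x|x].
- by have /graphP := GM _ _ _ (mem_graph x) (mem_graph y) (mem_graph z).
- by have /graphP := Ga _ (imageP _ (mem_graph x)).
- by have /graphP := Gb _ (imageP _ (mem_graph x)).
Qed.
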